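(* Let $p>1$ and $q=p/(p-1)$, and let $(X_i)_{i\in\mathbb Z}$ be a stationary sequence of real random variables in $\mathbf L^p$ (not necessarily centered), adapted to $(\mathcal F_i)_{i\in\mathbb Z}$ (setting described in the context). Then: (i) for every positive integer $r$ and every integer $n\in[2^{r-1},2^r[$, $$ \Bigl\|\max_{1\le i\le n}|S_i|\Bigr\|_p\le 2q\max_{1\le m\le n}\|S_m\|_p+(2^{1/p}q)\,n^{1/p}\sum_{l=0}^{r-1}2^{-l/p}\|\mathbf E(S_{2^l}\mid\mathcal F_0)\|_p ; $$ (ii) for every positive integer $n$, $$ \Bigl\|\max_{1\le i\le n}|S_i|\Bigr\|_p\le 2q\max_{1\le m\le n}\|S_m\|_p+\Bigl(q\frac{2^{2+2/p}}{2^{1+1/p}-1}\Bigr)n^{1/p}\sum_{j=1}^{n}j^{-1-1/p}\|\mathbf E(S_j\mid\mathcal F_0)\|_p . $$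
   Context: Setting: $(\Omega,\mathcal A,\mathbf P)$ is a probability space and $T:\Omega\to\Omega$ is a bijective bi-measurable transformation preserving $\mathbf P$. $\mathcal F_0\subseteq\mathcal A$ is a $\sigma$-algebra with $\mathcal F_0\subseteq T^{-1}(\mathcal F_0)$, and $\mathcal F_i=T^{-i}(\mathcal F_0)$, $i\in\mathbb Z$. $X_0$ is a real-valued random variable and $X_i=X_0\circ T^i$. The sequence is adapted if $X_0$ is $\mathcal F_0$-measurable. $\|X\|_p$ is the norm in $\mathbf L^p$ and $S_n=\sum_{j=1}^nX_j$. *)

(* Defs.v *)
From HB Require Import structures.
From mathcomp Require Import all_boot all_order all_algebra.
From mathcomp Require Import all_classical all_reals all_analysis.
From mathcomp Require Import measurable_realfun.

Set Implicit Arguments.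
Unset Strict Implicit.
Unset Printing Implicit Defensive.

Import Order.TTheory GRing.Theory Num.Theory.
Import numFieldNormedType.Exports.

Local Open Scope classical_set_scope.
Local Open Scope ring_scope.

(* T^i for an integer i, where Tinv is the inverse of the bijection T. *)
Definition iterz (U : Type) (T Tinv : U -> U) (i : int) : U -> U :=
  match i with
  | Posz n => iter n T
  | Negz n => iter n.+1 Tinv
  end.

Section conditional_expectation.
Local Open Scope ereal_scope.
Context d (Omega : measurableType d) (R : realType).
Variables (P : probability Omega R) (G : set_system Omega).

(* Y is a version of E(X | G). When G is a sigma-algebra, the measurable sets
   of [g_sigma_algebraType G] are exactly the members of G, so the first clause
   says that Y is G-measurable. *)
Definition is_cond_exp (X Y : Omega -> R) : Prop :=
  [/\ measurable_fun [set: g_sigma_algebraType G] (Y : g_sigma_algebraType G -> R),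
      P.-integrable [set: Omega] (EFin \o Y) &
      forall A, G A ->
        \int[P]_(w in A) (Y w)%:E = \int[P]_(w in A) (X w)%:E].

(* A chosen version; [cond_expP] shows that one exists for integrable X, so that
   the default value of [xget] is irrelevant. *)
Definition cond_exp (X : Omega -> R) : Omega -> R :=
  xget (cst 0%R) [set Y | is_cond_exp X Y].

Hypotheses (sG : sigma_algebra [set: Omega] G) (Gm : G `<=` measurable).

Lemma cond_exp_exists (X : Omega -> R) :
  P.-integrable [set: Omega] (EFin \o X) -> exists Y, is_cond_exp X Y.
Proof.
move=> iX.
pose toG : Omega -> g_sigma_algebraType G := id.
have GE A : G A -> G.-sigma.-measurable A by exact: sub_sigma_algebra.
have Gmeas A : G.-sigma.-measurable A -> d.-measurable A.
  by rewrite measurable_g_measurableTypeE//; exact: Gm.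
have mtoG : measurable_fun [set: Omega] toG.
  by move=> _ A mA; rewrite setTI; exact: Gmeas.
pose toGm : {mfun Omega >-> g_sigma_algebraType G} :=
  HB.pack toG (isMeasurableFun.Build _ _ _ _ toG mtoG).
pose PG : probability (g_sigma_algebraType G) R := distribution P toGm.
pose nu_of : {charge set (g_sigma_algebraType G) -> \bar R} :=
  pushforward (induced_charge iX) toG.
pose nu := nu_of mtoG.
have nuPG : nu `<< PG.
  apply/null_content_dominatesP => A mA PA0.
  have mX (B : set Omega) : measurable_fun B (EFin \o X).
    apply: (@measurable_funS _ _ Omega _ setT) => //.
    exact: (measurable_int P iX).
  exact: (null_set_integral (Gmeas _ mA) (mX _) PA0).
pose f := Radon_Nikodym nu PG.
have iPGf : PG.-integrable [set: g_sigma_algebraType G] f.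
  exact: Radon_Nikodym_integrable.
have mf : measurable_fun [set: g_sigma_algebraType G] f.
  exact: measurable_int iPGf.
have iPf : P.-integrable [set: Omega] f.
  apply/integrableP; split; first exact: (measurableT_comp mf mtoG).
  case/integrableP : iPGf => _; rewrite ge0_integral_pushforward//=.
  exact: measurableT_comp.
have fE w : (fine (f w))%:E = f w by rewrite fineK// Radon_Nikodym_fin_num.
exists (fine \o f); split.
- exact: measurableT_comp.
- by apply: eq_integrable iPf => // w _; rewrite /= fE.
- move=> A GA; under eq_integral do rewrite /= fE.
  have := Radon_Nikodym_integral nuPG (GE _ GA).
  have iPfA : P.-integrable (toG @^-1` A) (f \o toG).
    by apply: (integrableS _ _ _ iPf) => //; exact: Gm.
  rewrite (integral_pushforward mtoG mf iPfA (GE _ GA)).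
  by move=> <-.
Qed.

Lemma cond_expP (X : Omega -> R) :
  P.-integrable [set: Omega] (EFin \o X) -> is_cond_exp X (cond_exp X).
Proof.
move=> /cond_exp_exists[Y XY]; exact: (xgetPex _ (ex_intro _ Y XY)).
Qed.

End conditional_expectation.

(* Main.v *)
Require Import Defs.
From HB Require Import structures.
From mathcomp Require Import all_boot all_order all_algebra.
From mathcomp Require Import all_classical all_reals all_analysis.
From mathcomp Require Import measurable_realfun.
From mathcomp Require Import zify ring lra.

(** For a fixed [n], write [S_j = E(S_n | F_j) - E(S_n - S_j | F_j)].  The first
term is a martingale, and Doob's inequality bounds its maximum by [q ||S_n||_p].
For the second one, expand [n - j] in base 2, which cuts [S_n - S_j] into dyadic
blocks laid out backwards from [n].  A block of length [2^l] starts at a time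
[b = n - k 2^l >= j], so its conditional expectation given [F_j] is dominated, in
the sense of integrals over the sets of [F_j], by
[Z_l = (\sum_k |E(S_{2^l} | F_0) o T^(n - k 2^l)|^p)^(1/p)], where [k] ranges
over [1 .. n / 2^l].  Doob's inequality for processes dominated by a fixed [Z_l]
gives [q ||Z_l||_p <= q (n / 2^l)^(1/p) ||E(S_{2^l} | F_0)||_p].  This is (i), with
better constants.  Part (ii) follows because [j |-> ||E(S_j | F_0)||_p] is
subadditive, so that its value at [2^l] is at most twice its mean over [1 .. 2^l].

Doob's inequality is proved pathwise: with [s_j] the running maximum truncated
at [K], Young's inequality gives
[s_n^p <= q \sum_j |M_j| (s_j^(p-1) - s_{j-1}^(p-1))], and integrating against
the domination telescopes the right-hand side into [q Z s_n^(p-1)].  *)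

Set Implicit Arguments.
Unset Strict Implicit.
Unset Printing Implicit Defensive.

Import Order.TTheory GRing.Theory Num.Theory.
Import numFieldNormedType.Exports.

Local Open Scope classical_set_scope.
Local Open Scope ring_scope.

(** * Domination on a sub-sigma-algebra *)

Import HBNNSimple.

Section domination.
Context d (Omega : measurableType d) (R : realType).
Variables (mu : {measure set Omega -> \bar R}) (G : set_system Omega).
Hypotheses (sG : sigma_algebra [set: Omega] G) (Gm : G `<=` measurable).

Lemma sub_measurable_fun (f : Omega -> R) :
  measurable_fun [set: g_sigma_algebraType G] (f : g_sigma_algebraType G -> R) ->
  measurable_fun [set: Omega] f.
Proof.
move=> mf _ B mB; apply: Gm.
by rewrite -[X in X _](measurable_g_measurableTypeE sG); exact: mf.
Qed.

Let preimage1_nnsfunP (h : {nnsfun g_sigma_algebraType G >-> R}) y :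
  G (h @^-1` [set y]).
Proof.
by rewrite -[X in X _](measurable_g_measurableTypeE sG); exact: measurable_funPTI.
Qed.

(** The level sets of a [G]-simple function belong to [G], so the weighted integral becomes a
    nonnegative combination of integrals of [u] over sets of [G], which are the only ones the
    domination controls. *)
Let integral_mul_nnsfun (u : Omega -> R) (h : {nnsfun g_sigma_algebraType G >-> R}) :
  measurable_fun setT u -> (forall w, 0 <= u w) ->
  (\int[mu]_w (u w * h w)%:E =
   \sum_(y \in range h) y%:E * \int[mu]_(w in h @^-1` [set y]) (u w)%:E)%E.
Proof.
move=> mu_ u0.
have mh y : measurable (h @^-1` [set y] : set Omega).
  by apply: Gm; exact: preimage1_nnsfunP.
have mhu y : measurable_fun [set: Omega] (fun w => u w * \1_(h @^-1` [set y]) w).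
  by apply: measurable_funM => //; exact: measurable_indic.
transitivity (\int[mu]_w (\sum_(y \in range h)
    (y * (u w * \1_(h @^-1` [set y]) w))%:E))%E.
  apply: eq_integral => w _; rewrite fsumEFin; last exact: fimfunP.
  congr EFin; rewrite [in LHS]fimfunE mulr_fsumr.
  by apply: eq_fsbigr => y _; rewrite mulrCA.
rewrite ge0_integral_fsum//; first last.
- move=> y w _; rewrite lee_fin mulrCA mulr_ge0//.
  exact: (nnfun_muleindic_ge0 h y w).
- by move=> y; apply/measurable_EFinP; apply: measurable_funM.
apply: eq_fsbigr => y; rewrite inE => -[w _ <-].
under eq_integral do rewrite EFinM.
rewrite ge0_integralZl_EFin//; last exact/measurable_EFinP.
- congr (_ * _)%E; rewrite [RHS]integral_mkcond; apply: eq_integral => x _.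
  rewrite patchE indicE; case: ifPn => _; first by rewrite mulr1.
  by rewrite mulr0.
- by move=> x _; rewrite lee_fin mulr_ge0.
Qed.

(** True for [G]-simple weights by linearity, then for [h] by monotone convergence. *)
Lemma le_integral_mul (u v h : Omega -> R) :
  measurable_fun setT u -> (forall w, 0 <= u w) ->
  measurable_fun setT v -> (forall w, 0 <= v w) ->
  (forall A, G A ->
    \int[mu]_(w in A) (u w)%:E <= \int[mu]_(w in A) (v w)%:E)%E ->
  measurable_fun [set: g_sigma_algebraType G] (h : g_sigma_algebraType G -> R) ->
  (forall w, 0 <= h w) ->
  (\int[mu]_w (u w * h w)%:E <= \int[mu]_w (v w * h w)%:E)%E.
Proof.
move=> mu_ u0 mv v0 uv mh h0.
have mEh : measurable_fun [set: g_sigma_algebraType G]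
    (EFin \o h : g_sigma_algebraType G -> \bar R) by exact/measurable_EFinP.
(* The approximation is taken on [g_sigma_algebraType G], not on [Omega], so that its level sets lie
   in [G]. *)
pose hn := nnsfun_approx measurableT mEh.
have mhn n : measurable_fun [set: Omega] (hn n : Omega -> R).
  by apply: sub_measurable_fun; exact: measurable_funPT.
have hcvg w : ((hn n w)%:E @[n --> \oo] --> (h w)%:E)%E.
  exact: (@cvg_nnsfun_approx _ _ _ _ measurableT _ mEh (fun x _ => h0 x) w).
have approx (f : Omega -> R) : measurable_fun setT f -> (forall w, 0 <= f w) ->
    (\int[mu]_w (f w * hn n w)%:E @[n --> \oo] --> \int[mu]_w (f w * h w)%:E)%E.
  move=> mf f0.
  rewrite [X in _ --> X](_ : _ =
      (\int[mu]_w limn (fun n => (f w * hn n w)%:E))%E).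
    apply: cvg_monotone_convergence => //.
    - by move=> n; apply/measurable_EFinP; exact: measurable_funM.
    - by move=> n w _; rewrite lee_fin mulr_ge0.
    - move=> w _ m n mn; rewrite lee_fin ler_wpM2l//.
      by have /lefP := nd_nnsfun_approx measurableT mEh mn; apply.
  apply: eq_integral => w _; apply/esym/cvg_lim => //.
  under eq_fun do rewrite EFinM.
  by rewrite EFinM; exact: (cvgeZl _ (hcvg w)).
rewrite -(cvg_lim _ (approx u _ _))// -(cvg_lim _ (approx v _ _))//.
apply: lee_lim; [by apply/cvg_ex; eexists; exact: approx..|].
apply: nearW => n; rewrite !integral_mul_nnsfun//.
apply: lee_fsum; first exact: fimfunP.
move=> y [w _ <-]; apply: lee_wpmul2l; first by rewrite lee_fin.
by apply: uv; exact: preimage1_nnsfunP.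
Qed.
End domination.

Lemma measurable_fun_powRl d (T : measurableType d) (R : realType) (r : R)
    (f : T -> R) :
  measurable_fun setT f -> measurable_fun setT (fun w => f w `^ r).
Proof. exact: (@measurableT_comp _ _ _ _ _ _ (fun x => x `^ r) _ f). Qed.

(** * Norm bounds from truncated moments *)

Section truncation.
Context d (Omega : measurableType d) (R : realType).
Variables (mu : {finite_measure set Omega -> \bar R}) (p : R).
Hypothesis p1 : 1 < p.

Let p0 : 0 < p. Proof. exact: lt_trans ltr01 p1. Qed.

Lemma LnormE (f : Omega -> R) :
  'N[mu]_p%:E[EFin \o f]%E = ((\int[mu]_w (`|f w| `^ p)%:E) `^ p^-1)%E.
Proof.
by rewrite unlock; congr (_ `^ _)%E; apply: eq_integral => w _ /=; rewrite poweR_EFin.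
Qed.

Lemma Lnorm_powE (f : Omega -> R) :
  ('N[mu]_p%:E[EFin \o f] `^ p = \int[mu]_w (`|f w| `^ p)%:E)%E.
Proof.
by rewrite powR_Lnorm ?gt_eqF.
Qed.

Let min_nat (f : Omega -> R) (K : nat) w := Num.min (f w) K%:R.

(** Hölder bounds the right-hand integral by [||g||_p N^(p-1)], where [N] is the norm of the
    truncation of [f] at [K]. Truncation makes [N] finite, so [N^(p-1)] can be cancelled although
    [f] is not known to be in [L^p]; then [K] tends to infinity. *)
Lemma Lnorm_le_truncation (c : R) (f g : Omega -> R) :
  0 <= c ->
  measurable_fun setT f -> (forall w, 0 <= f w) ->
  measurable_fun setT g -> (forall w, 0 <= g w) ->
  (forall K : nat, \int[mu]_w (Num.min (f w) K%:R `^ p)%:E <=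
     c%:E * \int[mu]_w (g w * Num.min (f w) K%:R `^ (p - 1))%:E)%E ->
  ('N[mu]_p%:E[EFin \o f] <= c%:E * 'N[mu]_p%:E[EFin \o g])%E.
Proof.
move=> c0 mf f0 mg g0 fg.
have h0 K w : 0 <= min_nat f K w by rewrite le_min f0 ler0n.
have mh K : measurable_fun setT (min_nat f K) by exact: measurable_minr.
have hle K : ('N[mu]_p%:E[EFin \o min_nat f K] <= c%:E * 'N[mu]_p%:E[EFin \o g])%E.
  set N := 'N[mu]_p%:E[EFin \o min_nat f K]%E.
  have N_powE : (N `^ p = \int[mu]_w (min_nat f K w `^ p)%:E)%E.
    by rewrite Lnorm_powE; apply: eq_integral => w _; rewrite ger0_norm.
  have Nfin : N \is a fin_num.
    rewrite ge0_fin_numE ?Lnorm_ge0// /N LnormE.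
    apply: poweR_lty.
    apply: (@le_lt_trans _ _ (\int[mu]_w (K%:R `^ p)%:E)%E).
      apply: ge0_le_integral => //.
      - apply/measurable_EFinP; apply: measurable_fun_powRl; exact: measurableT_comp.
      - move=> w _; rewrite lee_fin ger0_norm//; apply: ge0_ler_powR => //.
        + exact: ltW.
        + by rewrite nnegrE.
        + by rewrite nnegrE.
        + by rewrite ge_min lexx orbT.
    rewrite integral_cst//= lte_mul_pinfty ?lee_fin ?powR_ge0//.
    by rewrite ltey_eq fin_num_measure.
  have N0 : (0 <= N)%E by exact: Lnorm_ge0.
  have [->|Nneq0] := eqVneq N 0%E; first by rewrite mule_ge0 ?Lnorm_ge0 ?lee_fin.
  have Npos : (0 < N)%E by rewrite lt0e Nneq0.
  pose q := p / (p - 1).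
  have q0 : 0 < q by rewrite /q divr_gt0// subr_gt0.
  have pq1 : p^-1 + q^-1 = 1.
    by rewrite /q; field; rewrite subr_eq0 !gt_eqF.
  have holder : (\int[mu]_w (g w * min_nat f K w `^ (p - 1))%:E <=
      'N[mu]_p%:E[EFin \o g] * N `^ (p - 1))%E.
    have mhp : measurable_fun setT (fun w => min_nat f K w `^ (p - 1)).
      exact: measurable_fun_powRl.
    have := hoelder mu mg mhp p0 q0 pq1.
    rewrite Lnorm1; under eq_integral do rewrite /= ger0_norm ?mulr_ge0 ?powR_ge0//.
    move=> /le_trans; apply; apply: lee_wpmul2l; first exact: Lnorm_ge0.
    (* Since [(p - 1) q = p], the [L^q] norm of the weight is a power of [N]. *)
    have -> : 'N[mu]_q%:E[EFin \o (fun w => (min_nat f K w `^ (p - 1))%R)]%E =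
        ((\int[mu]_w (min_nat f K w `^ p)%:E) `^ q^-1)%E.
      rewrite unlock; congr (_ `^ _)%E; apply: eq_integral => w _ /=.
      rewrite ger0_norm ?powR_ge0// -powRrM; congr EFin; congr powR.
      by rewrite /q; field; rewrite subr_eq0 gt_eqF.
    rewrite -N_powE -poweRrM (_ : p * q^-1 = p - 1)//.
    by rewrite /q; field; rewrite subr_eq0 !gt_eqF.
  have powN : (N `^ p = N * N `^ (p - 1))%E.
    rewrite -(fineK Nfin) !poweR_EFin -EFinM mulr_powRB1// fine_ge0//.
  have : (N * N `^ (p - 1) <= c%:E * 'N[mu]_p%:E[EFin \o g] * N `^ (p - 1))%E.
    rewrite -powN N_powE; apply: (le_trans (fg K)).
    by rewrite -muleA; apply: lee_wpmul2l; rewrite ?lee_fin.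
  rewrite -(fineK Nfin) poweR_EFin lee_pmul2r//.
  by rewrite lte_fin powR_gt0// fine_gt0// Npos ltey_eq Nfin.
set C := (c%:E * 'N[mu]_p%:E[EFin \o g])%E in hle *.
have C0 : (0 <= C)%E by rewrite mule_ge0 ?Lnorm_ge0 ?lee_fin.
(* With [C], possibly infinite, written as a [p]-th root, it remains to compare integrals of [p]-th
   powers, where monotone convergence in [K] applies. *)
have -> : C = ((C `^ p) `^ p^-1)%E.
  by rewrite -poweRrM mulfV ?gt_eqF// poweRe1.
rewrite LnormE; apply: gt0_ler_poweR; rewrite ?in_itv/= ?leey ?andbT.
- by rewrite invr_ge0 ltW.
- by apply: integral_ge0 => w _; rewrite lee_fin powR_ge0.
- exact: poweR_ge0.
have : (\int[mu]_w (min_nat f K w `^ p)%:E @[K --> \oo] --> 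
    \int[mu]_w (`|f w| `^ p)%:E)%E.
  rewrite [X in _ --> X](_ : _ =
      (\int[mu]_w limn (fun K => (min_nat f K w `^ p)%:E))%E).
    apply: cvg_monotone_convergence => //.
    - move=> K; apply/measurable_EFinP.
      exact: measurable_fun_powRl.
    - by move=> K w _; rewrite lee_fin powR_ge0.
    - move=> w _ m n mn; rewrite lee_fin; apply: ge0_ler_powR.
      + exact: ltW.
      + by rewrite nnegrE.
      + by rewrite nnegrE.
      + by rewrite /min_nat le_min !ge_min lexx/= ler_nat mn orbT.
  apply: eq_integral => w _; apply/esym/cvg_lim => //.
  (* The truncation has no effect once [K] exceeds [f w]. *)
  apply: cvg_near_cst; near=> K.
  rewrite ger0_norm// /min_nat min_l//; apply: ltW.
  near: K; exact: nbhs_infty_gtr.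
move=> /cvg_lim <-//; apply: lime_le.
  apply: ereal_nondecreasing_is_cvgn => m n mn.
  apply: ge0_le_integral => //.
  - by move=> w _; rewrite lee_fin powR_ge0.
  - by apply/measurable_EFinP; exact: measurable_fun_powRl.
  - by apply/measurable_EFinP; exact: measurable_fun_powRl.
  - move=> w _; rewrite lee_fin; apply: ge0_ler_powR.
    + exact: ltW.
    + by rewrite nnegrE.
    + by rewrite nnegrE.
    + by rewrite /min_nat le_min !ge_min lexx/= ler_nat mn orbT.
apply: nearW => K.
have -> : (\int[mu]_w (min_nat f K w `^ p)%:E = 'N[mu]_p%:E[EFin \o min_nat f K] `^ p)%E.
  by rewrite Lnorm_powE; apply: eq_integral => w _; rewrite ger0_norm.
by apply: gt0_ler_poweR; rewrite ?in_itv/= ?leey ?andbT ?Lnorm_ge0// ltW.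
Unshelve. all: by end_near. Qed.

End truncation.

(** * Doob's maximal inequality *)

(* [Num.max] is not a monoid law with unit [0] on the whole of [R], so that
   [big_nat_recr] does not apply. *)
Lemma bigmaxr_nat_recr (R : realDomainType) (f : nat -> R) (n : nat) : 0 <= f n.+1 ->
  \big[Num.max/0]_(1 <= i < n.+2) f i =
  Num.max (\big[Num.max/0]_(1 <= i < n.+1) f i) (f n.+1).
Proof.
move=> fn0; rewrite /index_iota !subSS !subn0.
have -> : iota 1 n.+1 = iota 1 n ++ [:: n.+1] by rewrite -[in LHS](addn1 n) iotaD add1n.
rewrite big_cat_nested big_cons big_nil.
elim: (iota 1 n) => [|i s IH]; first by rewrite !big_nil maxC.
by rewrite !big_cons IH maxA.
Qed.

Section doob.
Context d (Omega : measurableType d) (R : realType).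
Variables (mu : {finite_measure set Omega -> \bar R}) (p q : R).
Hypotheses (p1 : 1 < p) (qE : q = p / (p - 1)).

Let p0 : 0 < p. Proof. exact: lt_trans ltr01 p1. Qed.
Let q0 : 0 < q. Proof. by rewrite qE divr_gt0// subr_gt0. Qed.

(* Young's inequality [t' * t^(p-1) <= t'^p / p + t^p / q], rearranged. *)
Let powR_increment (t t' m : R) : 0 <= t -> t <= t' -> (t < t' -> t' <= m) ->
  t' `^ p <= t `^ p + q * (m * (t' `^ (p - 1) - t `^ (p - 1))).
Proof.
move=> t0; rewrite le_eqVlt => /predU1P[<- _|tt' /(_ tt') t'm].
  by rewrite subrr !mulr0 addr0.
have t'0 : 0 <= t' by rewrite (le_trans t0)// ltW.
have pq1 : p^-1 + q^-1 = 1.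
  by rewrite qE; field; rewrite subr_eq0 !gt_eqF.
have := conjugate_powR t'0 (powR_ge0 t (p - 1)) p0 q0 pq1.
rewrite -powRrM (_ : (p - 1) * q = p); last first.
  by rewrite qE; field; rewrite subr_eq0 gt_eqF.
rewrite -(ler_pM2l q0) mulrDr [X in _ <= _ + X]mulrC mulfVK ?gt_eqF// => young.
have inc : t `^ (p - 1) <= t' `^ (p - 1).
  by apply: ge0_ler_powR; rewrite ?nnegrE ?subr_ge0 ?(ltW p1) ?(ltW tt').
have : q * (t' * (t' `^ (p - 1) - t `^ (p - 1))) <=
    q * (m * (t' `^ (p - 1) - t `^ (p - 1))).
  by rewrite ler_pM2l// ler_wpM2r// subr_ge0.
rewrite mulrBr mulr_powRB1// mulrBr.
(* This is [q = 1 + q / p], the conjugacy of [p] and [q]. *)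
have -> : q * t' `^ p = t' `^ p + q * (t' `^ p / p).
  rewrite qE; field; rewrite subr_eq0 !gt_eqF//.
lra.
Qed.

Variables (n : nat) (F : nat -> set_system Omega).
Hypotheses (sF : forall j, sigma_algebra [set: Omega] (F j))
  (Fm : forall j, F j `<=` measurable) (F_nd : forall i j, (i <= j)%N -> F i `<=` F j).

Lemma sub_measurable_fun_le i j (f : Omega -> R) : (i <= j)%N ->
  measurable_fun [set: g_sigma_algebraType (F i)] (f : g_sigma_algebraType (F i) -> R) ->
  measurable_fun [set: g_sigma_algebraType (F j)] (f : g_sigma_algebraType (F j) -> R).
Proof.
move=> ij mf _ B mB.
rewrite [X in X _](measurable_g_measurableTypeE (sF j)); apply: (F_nd ij).
by rewrite -[X in X _](measurable_g_measurableTypeE (sF i)); exact: mf.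
Qed.

(** Stated for domination by a fixed [Z] so as to serve twice: for a martingale, with [Z] the
    modulus of its last term, and for the dyadic blocks, with a [Z] built from all possible starting
    times. *)
Theorem doob_maximal (M : nat -> Omega -> R) (Z : Omega -> R) :
  (forall j, (j <= n)%N ->
    measurable_fun [set: g_sigma_algebraType (F j)]
      (M j : g_sigma_algebraType (F j) -> R)) ->
  measurable_fun setT Z -> (forall w, 0 <= Z w) ->
  (forall j A, (j <= n)%N -> F j A ->
    \int[mu]_(w in A) `|M j w|%:E <= \int[mu]_(w in A) (Z w)%:E)%E ->
  ('N[mu]_p%:E[EFin \o (fun w => \big[Num.max/0%R]_(1 <= i < n.+1) `|M i w|%R)]
    <= q%:E * 'N[mu]_p%:E[EFin \o Z])%E.
Proof.
move=> mM mZ Z0 MZ.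
pose s j w : R := \big[Num.max/0%R]_(1 <= i < j.+1) `|M i w|%R.
have s0 w : s 0%N w = 0 by rewrite /s big_geq.
have sS j w : s j.+1 w = Num.max (s j w) `|M j.+1 w| by rewrite /s bigmaxr_nat_recr.
have s_ge0 j w : 0 <= s j w.
  by elim: j => [|j IH]; rewrite ?s0// sS le_max IH.
have ms j : (j <= n)%N -> measurable_fun [set: g_sigma_algebraType (F j)]
    (s j : g_sigma_algebraType (F j) -> R).
  elim: j => [_|j IH jn]; first by rewrite (_ : s 0%N = cst 0)//; exact/funext.
  rewrite (_ : s j.+1 = s j \max (fun w => `|M j.+1 w|)); last first.
    by apply/funext => w; rewrite sS.
  apply: measurable_maxr; last by apply: measurableT_comp => //; exact: mM.
  by apply: (@sub_measurable_fun_le j) => //; exact: (IH (ltnW jn)).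
have mMO j : (j <= n)%N -> measurable_fun [set: Omega] (M j).
  by move=> jn; apply: (sub_measurable_fun (sF j) (@Fm j)); exact: mM.
apply: (Lnorm_le_truncation p1 (ltW q0)) => //.
- by apply: (sub_measurable_fun (sF n) (@Fm n)); exact: ms.
- by move=> w; exact: s_ge0.
move=> K.
(* [t] is the truncated running maximum and [h j] the increment of its power [p - 1]; [h j] is
   nonnegative and [F j.+1]-measurable, hence an admissible weight against [M j.+1]. *)
pose t j w : R := Num.min (s j w) K%:R.
pose phi j w : R := t j w `^ (p - 1).
pose h j w : R := phi j.+1 w - phi j w.
have t0 j w : 0 <= t j w by rewrite le_min s_ge0 ler0n.
have tS j w : t j w <= t j.+1 w.
  by rewrite /t le_min !ge_min lexx orbT andbT sS le_max lexx.
have h0 j w : 0 <= h j w.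
  rewrite /h /phi subr_ge0; apply: ge0_ler_powR; rewrite ?nnegrE ?t0 ?tS//.
  by rewrite subr_ge0 ltW.
have mphi j : (j <= n)%N -> measurable_fun [set: g_sigma_algebraType (F j)]
    (phi j : g_sigma_algebraType (F j) -> R).
  move=> jn; apply: measurable_fun_powRl.
  by apply: measurable_minr => //; exact: ms.
have mh j : (j < n)%N -> measurable_fun [set: g_sigma_algebraType (F j.+1)]
    (h j : g_sigma_algebraType (F j.+1) -> R).
  move=> jn; apply: measurable_funB; first exact: mphi.
  by apply: (@sub_measurable_fun_le j) => //; exact: (mphi j (ltnW jn)).
have mhO j : (j < n)%N -> measurable_fun [set: Omega] (h j).
  by move=> jn; apply: (sub_measurable_fun (sF j.+1) (@Fm j.+1)); exact: mh.
have path w m : t m w `^ p <= q * \sum_(j < m) `|M j.+1 w| * h j w.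
  elim: m => [|m IH].
    by rewrite big_ord0 mulr0 /t s0 min_l ?ler0n// powR0// gt_eqF.
  rewrite big_ord_recr/= mulrDr.
  (* The running maximum only increases by jumping to the new value. *)
  have tM : t m w < t m.+1 w -> t m.+1 w <= `|M m.+1 w|.
    rewrite /t sS; case: (leP (s m w) `|M m.+1 w|) => [_ _|_]; last by rewrite ltxx.
    by rewrite ge_min lexx.
  apply: (le_trans (powR_increment (t0 m w) (tS m w) tM)).
  by rewrite lerD2r.
have phi_sum w : \sum_(j < n) h j w = phi n w.
  rewrite -(big_mkord xpredT (fun j => h j w)) telescope_sumr//.
  (* The empty maximum is [0], and [0] to the power [p - 1] is [0] because this exponent is
     nonzero. *)
  have -> : phi 0%N w = 0 by rewrite /phi /t s0 min_l ?ler0n// powR0// subr_eq0 gt_eqF.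
  by rewrite subr0.
apply: (@le_trans _ _ (\int[mu]_w (q%:E * \sum_(j < n) (`|M j.+1 w| * h j w)%:E))%E).
  apply: ge0_le_integral => //.
  - by move=> w _; rewrite lee_fin powR_ge0.
  - apply/measurable_EFinP; apply: measurable_fun_powRl.
    apply: measurable_minr => //.
    by apply: (sub_measurable_fun (sF n) (@Fm n)); exact: ms.
  - apply: measurable_funeM; apply: emeasurable_sum => j.
    apply/measurable_EFinP; apply: measurable_funM; last exact: mhO.
    by apply: measurableT_comp => //; exact: mMO.
  - by move=> w _; rewrite sumEFin -EFinM lee_fin; exact: path.
rewrite ge0_integralZl_EFin ?(ltW q0)//; last 2 first.
- by move=> w _; apply: sume_ge0 => j _; rewrite lee_fin mulr_ge0.
- apply: emeasurable_sum => j.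
  apply/measurable_EFinP; apply: measurable_funM; last exact: mhO.
  by apply: measurableT_comp => //; exact: mMO.
apply: lee_wpmul2l; first by rewrite lee_fin ltW.
(* The weight on the right is telescoped backwards, so that the two sides can be compared term by
   term in [j]. *)
rewrite [X in (_ <= X)%E](_ : _ = \int[mu]_w (\sum_(j < n) (Z w * h j w)%:E))%E;
  last by apply: eq_integral => w _; rewrite sumEFin -mulr_sumr phi_sum.
rewrite !ge0_integral_sum//; first last.
- by move=> j w _; rewrite lee_fin mulr_ge0.
- move=> j; apply/measurable_EFinP; apply: measurable_funM; last exact: mhO.
  by apply: measurableT_comp => //; exact: mMO.
- by move=> j w _; rewrite lee_fin mulr_ge0.
- by move=> j; apply/measurable_EFinP; apply: measurable_funM => //; exact: mhO.
apply: lee_sum => j _.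
apply: (le_integral_mul (sF j.+1) (@Fm j.+1)) => //.
- by apply: measurableT_comp => //; exact: mMO.
- by move=> A FA; exact: MZ.
- exact: mh.
Qed.

End doob.

(** * Conditional expectations and norms *)

Section conditional_contraction.
Context d (Omega : measurableType d) (R : realType).
Variables (mu : {finite_measure set Omega -> \bar R}) (G : set_system Omega).
Hypotheses (sG : sigma_algebra [set: Omega] G) (Gm : G `<=` measurable).
Variables Y W : Omega -> R.
Hypotheses (mY : measurable_fun [set: g_sigma_algebraType G]
    (Y : g_sigma_algebraType G -> R))
  (iY : mu.-integrable setT (EFin \o Y)) (iW : mu.-integrable setT (EFin \o W))
  (YW : forall A, G A ->
    (\int[mu]_(w in A) (Y w)%:E = \int[mu]_(w in A) (W w)%:E)%E).

(** Cut [A] by the sign of [Y]: both pieces are in [G], and on each of them the integral of [|Y|]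
    is, up to sign, the integral of [Y], that is, of [W]. *)
Lemma le_integral_norm A : G A ->
  (\int[mu]_(w in A) `|Y w|%:E <= \int[mu]_(w in A) `|W w|%:E)%E.
Proof.
move=> GA.
have YO : measurable_fun setT Y by exact: (sub_measurable_fun sG Gm mY).
have WO : measurable_fun setT W by apply/measurable_EFinP; exact: measurable_int iW.
have GI (B : set R) : measurable B -> G (A `&` Y @^-1` B).
  move=> mB; rewrite -[X in X _](measurable_g_measurableTypeE sG).
  apply: measurableI; first by rewrite measurable_g_measurableTypeE.
  by rewrite -[_ @^-1` _]setTI; exact: mY.
pose B0 := A `&` Y @^-1` `[0, +oo[.
pose B1 := A `&` Y @^-1` `]-oo, 0[.
have AE : A = B0 `|` B1.
  rewrite -setIUr -preimage_setU [X in _ @^-1` X](_ : _ = setT) ?preimage_setT ?setIT//.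
  apply/seteqP; split => // x _ /=; rewrite !in_itv/= andbT.
  by case: (leP 0 x); [left|right].
have GB0 : G B0 by exact: GI.
have GB1 : G B1 by exact: GI.
have dB : [disjoint B0 & B1].
  apply/disj_setPS => w [[_]] /=; rewrite in_itv/= andbT => Y0 [_] /=.
  by rewrite in_itv/= ltNge Y0.
have mnorm (f : Omega -> R) (B : set Omega) : measurable_fun setT f ->
    measurable_fun B (fun w => `|f w|%:E).
  move=> mf; apply/measurable_EFinP; apply: measurableT_comp => //.
  exact: measurable_funTS.
have iS (f : Omega -> R) B : mu.-integrable setT (EFin \o f) -> G B ->
    mu.-integrable B (EFin \o f).
  by move=> iF GB; apply: (integrableS _ _ _ iF) => //; exact: Gm.
have key B : G B -> (`|\int[mu]_(w in B) (Y w)%:E| <= \int[mu]_(w in B) `|W w|%:E)%E.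
  move=> GB; rewrite YW//; apply: le_abse_integral; first exact: Gm.
  by apply/measurable_EFinP; exact: measurable_funTS.
rewrite AE !ge0_integral_setU//; try exact: Gm; try exact: mnorm.
apply: leeD.
  apply: le_trans (key _ GB0).
  rewrite (_ : (\int[mu]_(w in B0) `|Y w|%:E = \int[mu]_(w in B0) (Y w)%:E)%E).
    exact: lee_abs.
  apply: eq_integral => w; rewrite inE => -[_] /=; rewrite in_itv/= andbT => Y0.
  by rewrite ger0_norm.
apply: le_trans (key _ GB1); rewrite -abseN.
rewrite (_ : (\int[mu]_(w in B1) `|Y w|%:E = - \int[mu]_(w in B1) (Y w)%:E)%E).
  exact: lee_abs.
rewrite -integralN/=; last exact: (integrable_add_def (Gm GB1) (iS _ _ iY GB1)).
apply: eq_integral => w; rewrite inE => -[_] /=; rewrite in_itv/= => Y0.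
by rewrite ltr0_norm.
Qed.

Lemma Lnorm_norm (f : Omega -> R) (p : \bar R) :
  ('N[mu]_p[EFin \o (fun w => `|f w|%R)] = 'N[mu]_p[EFin \o f])%E.
Proof. exact: (Lnorm_abse mu (EFin \o f)). Qed.

(** The truncation lemma with [c = 1], the weight [min(|Y|, K)^(p-1)] being [G]-measurable; no
    conditional Jensen inequality is involved. *)
Lemma Lnorm_contraction (p : R) : 1 < p ->
  ('N[mu]_p%:E[EFin \o Y] <= 'N[mu]_p%:E[EFin \o W])%E.
Proof.
move=> p1; rewrite -Lnorm_norm -(Lnorm_norm W) -[leRHS]mul1e.
have YO : measurable_fun setT Y by exact: (sub_measurable_fun sG Gm mY).
have WO : measurable_fun setT W by apply/measurable_EFinP; exact: measurable_int iW.
have mN (f : Omega -> R) : measurable_fun setT f -> measurable_fun setT (fun w => `|f w|).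
  by move=> mf; exact: measurableT_comp.
apply: (Lnorm_le_truncation p1) => //; [exact: mN..|move=> K].
have m0 w : 0 <= Num.min `|Y w| K%:R by rewrite le_min normr_ge0 ler0n.
have mm : measurable_fun [set: g_sigma_algebraType G]
    ((fun w => Num.min `|Y w| K%:R) : g_sigma_algebraType G -> R).
  by apply: measurable_minr => //; exact: measurableT_comp.
have mmO := sub_measurable_fun sG Gm mm.
rewrite mul1e.
apply: (@le_trans _ _ (\int[mu]_w (`|Y w| * Num.min `|Y w| K%:R `^ (p - 1))%:E)%E).
  apply: ge0_le_integral => //.
  - by apply/measurable_EFinP; exact: measurable_fun_powRl.
  - apply/measurable_EFinP; apply: measurable_funM; first exact: mN.
    exact: measurable_fun_powRl.
  - move=> w _; rewrite lee_fin -(mulr_powRB1 (m0 w) (lt_trans ltr01 p1)).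
    by rewrite ler_wpM2r ?powR_ge0// ge_min lexx.
apply: (le_integral_mul sG Gm) => //; [exact: mN..|exact: le_integral_norm|].
exact: measurable_fun_powRl.
Qed.

End conditional_contraction.

Section Lnorm_lemmas.
Context d (Omega : measurableType d) (R : realType).
Variables (mu : {finite_measure set Omega -> \bar R}) (p : R).
Hypothesis p1 : 1 < p.

Let p0 : 0 < p. Proof. exact: lt_trans ltr01 p1. Qed.

Lemma le_Lnorm (f g : Omega -> R) :
  measurable_fun setT f -> measurable_fun setT g ->
  (forall w, `|f w| <= `|g w|) ->
  ('N[mu]_p%:E[EFin \o f] <= 'N[mu]_p%:E[EFin \o g])%E.
Proof.
move=> mf mg fg; rewrite !LnormE.
have mN (h : Omega -> R) : measurable_fun setT h ->
    measurable_fun setT (fun w => (`|h w| `^ p)%:E).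
  move=> mh; apply/measurable_EFinP; apply: measurable_fun_powRl.
  exact: measurableT_comp.
apply: gt0_ler_poweR; rewrite ?in_itv/= ?leey ?andbT ?invr_ge0 ?(ltW p0)//.
- by apply: integral_ge0 => w _; rewrite lee_fin powR_ge0.
- by apply: integral_ge0 => w _; rewrite lee_fin powR_ge0.
apply: ge0_le_integral => //; [exact: mN|exact: mN|].
move=> w _; rewrite lee_fin; apply: ge0_ler_powR; rewrite ?nnegrE ?(ltW p0)//.
Qed.

Lemma Lnorm_sum_le (I : Type) (s : seq I) (f : I -> Omega -> R) :
  (forall i, measurable_fun setT (f i)) ->
  ('N[mu]_p%:E[EFin \o (fun w => \sum_(i <- s) f i w)%R]
    <= \sum_(i <- s) 'N[mu]_p%:E[EFin \o f i])%E.
Proof.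
move=> mf; elim: s => [|i s IH].
  rewrite big_nil (_ : _ \o _ = cst 0%E) ?Lnorm0 ?eqe ?gt_eqF//.
  by apply/funext => w /=; rewrite big_nil.
rewrite big_cons (_ : (fun w => _) = f i \+ (fun w => \sum_(i <- s) f i w)).
  apply: (le_trans (eminkowski _ _ _ _)) => //; last exact: leeD.
  - exact: measurable_sum.
  - by rewrite lee_fin ltW.
by apply/funext => w /=; rewrite big_cons.
Qed.

(** The outer root is undone by the [p]-th power in the norm, so sum and integral can be
    exchanged. *)
Lemma Lnorm_lp_sum (I : Type) (s : seq I) (f : I -> Omega -> R) :
  (forall i, measurable_fun setT (f i)) ->
  ('N[mu]_p%:E[EFin \o (fun w => (\sum_(i <- s) `|f i w| `^ p) `^ p^-1)%R]
    = (\sum_(i <- s) 'N[mu]_p%:E[EFin \o f i] `^ p) `^ p^-1)%E.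
Proof.
move=> mf; rewrite LnormE; congr (_ `^ _)%E.
transitivity (\int[mu]_w (\sum_(i <- s) (`|f i w| `^ p)%:E))%E.
  apply: eq_integral => w _; rewrite sumEFin; congr EFin.
  rewrite ger0_norm ?powR_ge0// -powRrM mulVf ?gt_eqF// powRr1//.
  by apply: sumr_ge0 => i _; exact: powR_ge0.
rewrite ge0_integral_sum//.
- by apply: eq_bigr => i _; rewrite Lnorm_powE.
- move=> i; apply/measurable_EFinP; apply: measurable_fun_powRl.
  exact: measurableT_comp.
Qed.

(** * Composition with a measure-preserving map *)

Variable phi : Omega -> Omega.
Hypotheses (mphi : measurable_fun setT phi)
  (phi_mu : forall A, measurable A -> mu (phi @^-1` A) = mu A).

Lemma integrable_preserved (f : Omega -> R) :
  mu.-integrable setT (EFin \o f) -> mu.-integrable setT (EFin \o (f \o phi)).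
Proof.
move=> /integrableP[mf fy]; apply/integrableP; split.
  exact: (measurableT_comp mf mphi).
have <- : (\int[pushforward mu phi]_w `|(EFin \o f) w| =
    \int[mu]_w `|(EFin \o (f \o phi)) w|)%E.
  by rewrite ge0_integral_pushforward//; exact: measurableT_comp.
by rewrite (eq_measure_integral mu)// => A mA _; exact: phi_mu.
Qed.

Lemma integral_preserved (f : Omega -> R) (B : set Omega) : measurable B ->
  mu.-integrable setT (EFin \o f) ->
  (\int[mu]_(w in phi @^-1` B) (f (phi w))%:E = \int[mu]_(w in B) (f w)%:E)%E.
Proof.
move=> mB iF.
have mphiB : measurable (phi @^-1` B) by rewrite -[_ @^-1` _]setTI; exact: mphi.
rewrite -(@integral_pushforward _ _ _ _ _ _ mphi mu B (EFin \o f))//.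
- by apply: eq_measure_integral => A mA _; exact: phi_mu.
- exact: measurable_int iF.
- by apply: (integrableS _ _ _ (integrable_preserved iF)).
Qed.

Lemma Lnorm_preserved (f : Omega -> R) : measurable_fun setT f ->
  ('N[mu]_p%:E[EFin \o (f \o phi)] = 'N[mu]_p%:E[EFin \o f])%E.
Proof.
move=> mf; rewrite !LnormE; congr (_ `^ _)%E.
rewrite [RHS](_ : _ = (\int[pushforward mu phi]_w (`|f w| `^ p)%:E)%E).
  rewrite ge0_integral_pushforward//.
  apply/measurable_EFinP; apply: measurable_fun_powRl.
  exact: measurableT_comp.
apply: eq_measure_integral => A mA _; exact/esym/phi_mu.
Qed.

End Lnorm_lemmas.

(** * Stationary sequences *)

(** Erasing one more low-order binary digit of [i] removes the digit of rank [l], which is the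
    parity of [i %/ 2 ^ l]. *)
Lemma dyadic_trunc_step (l i : nat) :
  (i %/ 2 ^ l * 2 ^ l = i %/ 2 ^ l.+1 * 2 ^ l.+1 + odd (i %/ 2 ^ l) * 2 ^ l)%N.
Proof.
rewrite expnSr divnMA divn2; set k := (i %/ 2 ^ l)%N.
by rewrite -{1}(odd_double_half k) mulnDl addnC -muln2 -mulnA (mulnC 2).
Qed.

Section stationary.
Context (R : realType) (d : measure_display) (Omega : measurableType d).
Variables (P : probability Omega R) (T : Omega -> Omega).
Hypotheses (mT : measurable_fun [set: Omega] T)
  (PT : forall A : set Omega, measurable A -> P (T @^-1` A) = P A).
Variable F0 : set_system Omega.
Hypotheses (sF0 : sigma_algebra [set: Omega] F0) (F0m : F0 `<=` measurable)
  (F0T : F0 `<=` preimage_set_system [set: Omega] T F0).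
Variables (p q : R).
Hypotheses (p1 : 1 < p) (qE : q = p / (p - 1)).
Variable X0 : Omega -> R.
Hypotheses (X0Lp : X0 \in Lfun P p%:E)
  (X0F0 : measurable_fun [set: g_sigma_algebraType F0]
            (X0 : g_sigma_algebraType F0 -> R)).

Definition birkhoff_sum n w : R := \sum_(1 <= j < n.+1) X0 (iter j T w).
Local Notation S := birkhoff_sum.

Definition shifted_filtration j : set_system Omega :=
  preimage_set_system [set: Omega] (iter j T) F0.
Local Notation F := shifted_filtration.

Let p0 : 0 < p. Proof. exact: lt_trans ltr01 p1. Qed.
Let q0 : 0 < q. Proof. by rewrite qE divr_gt0// subr_gt0. Qed.

Lemma measurable_iter j : measurable_fun [set: Omega] (iter j T).
Proof.
elim: j => [|j IH]; first exact: measurable_id.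
exact: (measurableT_comp mT IH).
Qed.

Lemma measure_preimage_iter j A : measurable A -> P (iter j T @^-1` A) = P A.
Proof.
elim: j A => //= j IH A mA; rewrite -[RHS]PT// -[RHS]IH//.
by rewrite -[_ @^-1` _]setTI; exact: mT.
Qed.

Lemma sigma_algebra_shifted j : sigma_algebra [set: Omega] (F j).
Proof. exact: sigma_algebra_preimage. Qed.

Lemma shiftedP j A : F j A <-> exists2 B, F0 B & A = iter j T @^-1` B.
Proof.
split=> [[B FB <-]|[B FB ->]]; first by exists B => //; rewrite setTI.
by exists B => //; rewrite setTI.
Qed.

Lemma shifted_measurable j : F j `<=` measurable.
Proof.
move=> A /shiftedP[B FB ->]; rewrite -[_ @^-1` _]setTI.
by apply: measurable_iter => //; exact: F0m.
Qed.

Lemma shifted_nondecreasing i j : (i <= j)%N -> F i `<=` F j.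
Proof.
elim: j => [|j IH]; first by rewrite leqn0 => /eqP ->.
rewrite leq_eqVlt => /predU1P[->//|]; rewrite ltnS => /IH ij.
apply: (subset_trans ij) => A /shiftedP[B /F0T[B' FB' <-] ->].
by apply/shiftedP; exists B' => //; rewrite setTI.
Qed.

Lemma measurable_shifted j (f : Omega -> R) :
  measurable_fun [set: g_sigma_algebraType F0] (f : g_sigma_algebraType F0 -> R) ->
  measurable_fun [set: g_sigma_algebraType (F j)]
    (f \o iter j T : g_sigma_algebraType (F j) -> R).
Proof.
move=> mf _ B mB; rewrite setTI.
rewrite [X in X _](measurable_g_measurableTypeE (sigma_algebra_shifted j)).
apply/shiftedP; exists (f @^-1` B) => //.
rewrite -[X in X _](measurable_g_measurableTypeE sF0) -[_ @^-1` _]setTI.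
exact: mf.
Qed.

Lemma birkhoff_sumS n w : S n.+1 w = S n w + X0 (iter n.+1 T w).
Proof. by rewrite /S big_nat_recr. Qed.

Lemma birkhoff_sumD a b w : S (a + b) w = S a w + S b (iter a T w).
Proof.
elim: b => [|b IH]; first by rewrite addn0 {3}/S big_geq// addr0.
by rewrite addnS !birkhoff_sumS IH addrA -iterD addSn addnC.
Qed.

Lemma measurable_birkhoff_sum n :
  measurable_fun [set: g_sigma_algebraType (F n)]
    (S n : g_sigma_algebraType (F n) -> R).
Proof.
elim: n => [|n IH].
  by rewrite (_ : S 0 = cst 0)//; apply/funext => w; rewrite /S big_geq.
rewrite (_ : S n.+1 = S n \+ (X0 \o iter n.+1 T)); last first.
  by apply/funext => w; rewrite birkhoff_sumS.
apply: measurable_funD; last exact: measurable_shifted.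
exact: (sub_measurable_fun_le sigma_algebra_shifted shifted_nondecreasing (leqnSn n)).
Qed.

Let iX0 : P.-integrable setT (EFin \o X0).
Proof.
apply/Lfun1_integrable.
have p1e : (1 <= p%:E)%E by rewrite lee_fin ltW.
exact: (Lfun_subset (lexx _) p1e (fin_num_measure P _ measurableT) p1e).
Qed.

Let mX0 : measurable_fun setT X0.
Proof. by apply/measurable_EFinP; exact: measurable_int iX0. Qed.

Lemma integrable_birkhoff_sum n : P.-integrable setT (EFin \o S n).
Proof.
elim: n => [|n IH].
  rewrite (_ : _ \o _ = cst 0%E); first exact: integrable0.
  by apply/funext => w; rewrite /= /S big_geq.
rewrite (_ : _ \o _ = ((EFin \o S n) \+ (EFin \o (X0 \o iter n.+1 T)))%E).
  apply: integrableD => //; apply: integrable_preserved => //.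
  - exact: measurable_iter.
  - by move=> A mA; exact: measure_preimage_iter.
by apply/funext => w; rewrite /= birkhoff_sumS.
Qed.

Lemma birkhoff_sum_measurable n : measurable_fun setT (S n).
Proof. by apply/measurable_EFinP; exact: measurable_int (integrable_birkhoff_sum n). Qed.

Lemma Lnorm_birkhoff_sum_lty n : ('N[P]_p%:E[EFin \o S n] < +oo)%E.
Proof.
have mXi i : measurable_fun setT (X0 \o iter i T).
  by apply: measurableT_comp => //; exact: measurable_iter.
apply: (le_lt_trans (Lnorm_sum_le P p1 _ mXi)).
apply/lte_sum_pinfty => i _.
rewrite Lnorm_preserved//; last 2 first.
- exact: measurable_iter.
- by move=> A mA; exact: measure_preimage_iter.
by move: X0Lp => /andP[_]; rewrite inE.
Qed.

(** * Conditional expectations of partial sums *)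

Local Notation Y k := (cond_exp P F0 (S k)).

Let YP k : is_cond_exp P F0 (S k) (Y k).
Proof. by apply: cond_expP => //; exact: integrable_birkhoff_sum. Qed.

Let YF k : measurable_fun [set: g_sigma_algebraType F0]
  (Y k : g_sigma_algebraType F0 -> R).
Proof. by have [] := YP k. Qed.

Let iY k : P.-integrable setT (EFin \o Y k).
Proof. by have [] := YP k. Qed.

Let mY k : measurable_fun setT (Y k).
Proof. exact: (sub_measurable_fun sF0 F0m (YF k)). Qed.

Let mYi k b : measurable_fun setT (Y k \o iter b T).
Proof. by apply: measurableT_comp => //; exact: measurable_iter. Qed.

Let integrable_iter b (f : Omega -> R) : P.-integrable setT (EFin \o f) ->
  P.-integrable setT (EFin \o (f \o iter b T)).
Proof.
move=> iF; apply: integrable_preserved => //; first exact: measurable_iter.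
by move=> A mA; exact: measure_preimage_iter.
Qed.

Let Lnorm_iter b (f : Omega -> R) : measurable_fun setT f ->
  ('N[P]_p%:E[EFin \o (f \o iter b T)] = 'N[P]_p%:E[EFin \o f])%E.
Proof.
move=> mf; apply: Lnorm_preserved => //; first exact: measurable_iter.
by move=> A mA; exact: measure_preimage_iter.
Qed.

(** By stationarity, [Y k] composed with [T^b] is a version of the conditional expectation of the
    shifted sum given [F b], and [F b] contains [F j]. *)
Lemma cond_exp_shift k j b A : (j <= b)%N -> F j A ->
  (\int[P]_(w in A) ((Y k \o iter b T) w)%:E =
   \int[P]_(w in A) ((S k \o iter b T) w)%:E)%E.
Proof.
move=> jb /(shifted_nondecreasing jb)/shiftedP[B FB ->].
have mi := measurable_iter b.
have pi A' := @measure_preimage_iter b A'.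
rewrite (integral_preserved mi pi (F0m FB) (iY k)).
rewrite (integral_preserved mi pi (F0m FB) (integrable_birkhoff_sum k)).
by have [_ _] := YP k; apply.
Qed.

(** As [S (a + b)] is [S a] plus [S b] shifted by [a], only the shifted part needs work: its
    conditional expectation given [F0] is that of [Y b] shifted by [a], which has the norm of [Y b],
    and conditioning contracts norms. *)
Lemma Lnorm_cond_exp_subadditive a b :
  ('N[P]_p%:E[EFin \o Y (a + b)] <=
   'N[P]_p%:E[EFin \o Y a] + 'N[P]_p%:E[EFin \o Y b])%E.
Proof.
(* Taking a difference as the version of the shifted conditional expectation makes the decomposition
   of [Y (a + b)] exact at every point. *)
pose G w := Y (a + b) w - Y a w.
have mG : measurable_fun [set: g_sigma_algebraType F0]
    (G : g_sigma_algebraType F0 -> R) by exact: measurable_funB.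
have iG : P.-integrable setT (EFin \o G).
  by have := integrableB measurableT (iY (a + b)) (iY a).
have GY A : F0 A -> (\int[P]_(w in A) (G w)%:E =
    \int[P]_(w in A) ((Y b \o iter a T) w)%:E)%E.
  move=> FA; have mA := F0m FA.
  have F0A : F 0 A by apply/shiftedP; exists A.
  rewrite (cond_exp_shift b (leq0n a) F0A).
  have iS f : P.-integrable setT (EFin \o f) -> P.-integrable A (EFin \o f).
    by move=> iF; apply: (integrableS _ _ _ iF).
  transitivity (\int[P]_(w in A) (Y (a + b) w)%:E - \int[P]_(w in A) (Y a w)%:E)%E.
    by rewrite -integralB_EFin//; exact: iS.
  have [_ _ ->//] := YP (a + b); have [_ _ ->//] := YP a.
  rewrite -integralB_EFin//; try exact/iS/integrable_birkhoff_sum.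
  apply: eq_integral => w _; rewrite birkhoff_sumD -EFinB; congr EFin.
  by rewrite addrC addKr.
have -> : Y (a + b) = Y a \+ G by apply/funext => w; rewrite /G /= addrC subrK.
apply: (le_trans (minkowski_EFin _ _ _ _)); rewrite ?(ltW p1)//.
  exact: (sub_measurable_fun sF0 F0m mG).
apply: leeD => //; rewrite -(Lnorm_iter a (mY b)).
exact: (Lnorm_contraction sF0 F0m mG iG (integrable_iter a (iY b)) GY p1).
Qed.

Lemma Lnorm_cond_exp_lty k : ('N[P]_p%:E[EFin \o Y k] < +oo)%E.
Proof.
apply: le_lt_trans (Lnorm_birkhoff_sum_lty k).
have [_ _ YS] := YP k.
exact: (Lnorm_contraction sF0 F0m (YF k) (iY k) (integrable_birkhoff_sum k) YS p1).
Qed.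

(** * Backward dyadic decomposition *)

Variables (r n : nat).
Hypothesis nr : (n < 2 ^ r)%N.

(** [i] with its [l] lowest binary digits set to zero. *)
Let e l i := (i %/ 2 ^ l * 2 ^ l)%N.

Let e_le l i : (e l i <= i)%N. Proof. exact: leq_divM. Qed.

(* For [i = n - j], the dyadic block of level [l] in the decomposition of
   [S n - S j] is [S (n - e l.+1 i) - S (n - e l i)]: the blocks are laid out
   backwards from [n], the largest ones last, so that each of them starts at or
   after time [j]. *)
Let D l j w : R := S (n - e l.+1 (n - j)) w - S (n - e l (n - j)) w.

(** The block is empty when the digit of rank [l] of [n - j] is [0]. Otherwise
    [k = (n - j) %/ 2 ^ l] is odd, hence positive, and [k * 2 ^ l <= n - j] puts the start of the
    block at or after [j]. *)
Let DP l j : (j <= n)%N -> D l j = cst 0 \/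
  exists2 k, (1 <= k < (n %/ 2 ^ l).+1)%N &
    (j <= n - k * 2 ^ l)%N /\ D l j = S (2 ^ l) \o iter (n - k * 2 ^ l) T.
Proof.
move=> jn; set k := ((n - j) %/ 2 ^ l)%N.
have ele : (e l (n - j) <= n)%N by rewrite (leq_trans (e_le _ _))// leq_subr.
have := dyadic_trunc_step l (n - j); rewrite -/k.
have [k_odd|k_even] := boolP (odd k) => eE; last first.
  by left; apply/funext => w; rewrite /D /e -/k eE /= mul0n addn0 subrr.
right; exists k; first rewrite ltnS leq_div2r ?leq_subr// andbT.
  by case: (k) k_odd.
split.
  by have := e_le l (n - j); rewrite /e -/k => ?; lia.
apply/funext => w; rewrite /D.
have -> : (n - e l.+1 (n - j) = (n - k * 2 ^ l) + 2 ^ l)%N.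
  by move: ele eE; rewrite /e -/k; lia.
by rewrite birkhoff_sumD /e -/k addrC addKr.
Qed.

(** Telescoping in [l]: at level [0] nothing is erased from [n - j], and at level [r] everything is,
    because [n < 2 ^ r]. *)
Let D_sum j w : (j <= n)%N -> \sum_(l < r) D l j w = S n w - S j w.
Proof.
move=> jn; rewrite -(big_mkord xpredT (fun l => D l j w)).
rewrite (telescope_sumr (fun l => S (n - e l (n - j)) w))//.
rewrite /e expn0 divn1 muln1 subKn// divn_small ?mul0n ?subn0//.
by rewrite (leq_ltn_trans _ nr)// leq_subr.
Qed.

Let iD l j : P.-integrable setT (EFin \o D l j).
Proof.
by have := integrableB measurableT (integrable_birkhoff_sum (n - e l.+1 (n - j)))
  (integrable_birkhoff_sum (n - e l (n - j))).
Qed.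

Let M l j : Omega -> R := cond_exp P (F j) (D l j).

Let MP l j : is_cond_exp P (F j) (D l j) (M l j).
Proof.
apply: cond_expP => //; first exact: sigma_algebra_shifted.
exact: shifted_measurable.
Qed.

(** The start of the block depends on [j]; summing over all possible starts gives a bound free of
    [j], and the [l^p] sum makes its norm computable. *)
Let Z l w : R := (\sum_(1 <= k < (n %/ 2 ^ l).+1)
  `|(Y (2 ^ l) \o iter (n - k * 2 ^ l) T) w| `^ p) `^ p^-1.

Let Z0 l w : 0 <= Z l w. Proof. exact: powR_ge0. Qed.

Let mZ l : measurable_fun setT (Z l).
Proof.
apply: measurable_fun_powRl; apply: measurable_sum => k.
by apply: measurable_fun_powRl; apply: measurableT_comp => //; exact: mYi.
Qed.

Let le_Z l k w : (1 <= k < (n %/ 2 ^ l).+1)%N ->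
  `|(Y (2 ^ l) \o iter (n - k * 2 ^ l) T) w| <= Z l w.
Proof.
move=> kn; set y := `|_|.
have -> : y = (y `^ p) `^ p^-1 by rewrite -powRrM mulfV ?gt_eqF// powRr1// normr_ge0.
apply: ge0_ler_powR; rewrite ?nnegrE ?invr_ge0 ?(ltW p0) ?powR_ge0//.
  by apply: sumr_ge0 => i _; exact: powR_ge0.
rewrite (big_rem k) ?mem_index_iota//= lerDl.
by apply: sumr_ge0 => i _; exact: powR_ge0.
Qed.

(** On sets of [F j], [M l j] has the same integrals as one of the shifted [Y (2 ^ l)] entering
    [Z l], or as [0] when the block is empty. *)
Let M_le_Z l j A : (j <= n)%N -> F j A ->
  (\int[P]_(w in A) `|M l j w|%:E <= \int[P]_(w in A) (Z l w)%:E)%E.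
Proof.
move=> jn FA; have [MF iM MD] := MP l j.
have sFj := sigma_algebra_shifted j.
have Fmj : F j `<=` measurable by exact: shifted_measurable.
have mA := Fmj _ FA.
have [D0|[k kn [jk DE]]] := DP l jn.
  apply: (le_trans (le_integral_norm sFj Fmj MF iM (iD l j) MD FA)).
  rewrite D0; under eq_integral do rewrite normr0.
  by rewrite integral0; apply: integral_ge0 => w _; rewrite lee_fin.
have iYk := integrable_iter (n - k * 2 ^ l) (iY (2 ^ l)).
have MY B : F j B -> (\int[P]_(w in B) (M l j w)%:E =
    \int[P]_(w in B) ((Y (2 ^ l) \o iter (n - k * 2 ^ l) T) w)%:E)%E.
  by move=> FB; rewrite MD// (cond_exp_shift _ jk FB) DE.
apply: (le_trans (le_integral_norm sFj Fmj MF iM iYk MY FA)).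
apply: ge0_le_integral => //.
- apply/measurable_EFinP; apply: measurable_funTS.
  by apply: measurableT_comp => //; exact: mYi.
- by apply/measurable_EFinP; apply: measurable_funTS; exact: mZ.
- by move=> w _; rewrite lee_fin; exact: le_Z.
Qed.

(** For [j <= n], a version of the conditional expectation of [S n] given [F j], chosen so that
    [S j] is [M0 j] minus the block terms everywhere and not just almost surely. *)
Let M0 j w : R := S j w + \sum_(l < r) M l j w.

Let M0F j : measurable_fun [set: g_sigma_algebraType (F j)]
  (M0 j : g_sigma_algebraType (F j) -> R).
Proof.
apply: measurable_funD; first exact: measurable_birkhoff_sum.
by apply: measurable_sum => l; have [] := MP l j.
Qed.

Let iMsum j : P.-integrable setT (EFin \o (fun w => \sum_(l < r) M l j w)).
Proof.
rewrite (_ : _ \o _ = (fun w => \sum_(l < r) (M l j w)%:E)%E); last first.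
  by apply/funext => w; rewrite sumEFin.
by apply: integrable_sum => // l _; have [] := MP l j.
Qed.

Let iM0 j : P.-integrable setT (EFin \o M0 j).
Proof.
by have := integrableD measurableT (integrable_birkhoff_sum j) (iMsum j).
Qed.

Let M0_int j A : (j <= n)%N -> F j A ->
  (\int[P]_(w in A) (M0 j w)%:E = \int[P]_(w in A) (S n w)%:E)%E.
Proof.
move=> jn FA; have mA := @shifted_measurable j _ FA.
have iS f : P.-integrable setT (EFin \o f) -> P.-integrable A (EFin \o f).
  by move=> iF; apply: (integrableS _ _ _ iF).
have sumE (f : nat -> Omega -> R) : (forall l, P.-integrable setT (EFin \o f l)) ->
    (\int[P]_(w in A) (\sum_(l < r) f l w)%:E =
     \sum_(l < r) \int[P]_(w in A) (f l w)%:E)%E.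
  move=> iF; under eq_integral do rewrite -sumEFin.
  by rewrite integral_sum// => l; exact: iS.
transitivity (\int[P]_(w in A) (S j w)%:E +
    \int[P]_(w in A) (\sum_(l < r) M l j w)%:E)%E.
  by rewrite -integralD_EFin//; apply: iS => //; exact: integrable_birkhoff_sum.
rewrite (sumE (M^~ j)); last by move=> l; have [] := MP l j.
under eq_bigr => l _ do (have [_ _ ->//] := MP l j).
rewrite -(sumE (D^~ j))//; under [X in (_ + X)%E]eq_integral do rewrite D_sum//.
rewrite -integralD_EFin//.
- by apply: eq_integral => w _; rewrite -EFinD addrC subrK.
- by apply: iS; exact: integrable_birkhoff_sum.
- apply: iS.
  by have := integrableB measurableT (integrable_birkhoff_sum n)
    (integrable_birkhoff_sum j).
Qed.

(** * Maximal bounds for the terms of the decomposition *)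

Let maxf (f : nat -> Omega -> R) w : R := \big[Num.max/0%R]_(1 <= i < n.+1) `|f i w|%R.

Let doobM (f : nat -> Omega -> R) (z : Omega -> R) :
  (forall j, measurable_fun [set: g_sigma_algebraType (F j)]
    (f j : g_sigma_algebraType (F j) -> R)) ->
  measurable_fun setT z -> (forall w, 0 <= z w) ->
  (forall j A, (j <= n)%N -> F j A ->
    \int[P]_(w in A) `|f j w|%:E <= \int[P]_(w in A) (z w)%:E)%E ->
  ('N[P]_p%:E[EFin \o maxf f] <= q%:E * 'N[P]_p%:E[EFin \o z])%E.
Proof.
move=> mf mz z0 fz.
apply: (doob_maximal p1 qE sigma_algebra_shifted shifted_measurable
  shifted_nondecreasing) => // j _; exact: mf.
Qed.

(** By stationarity the [n %/ 2 ^ l] terms have equal norms, and their number is at most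
    [n / 2^l]. *)
Let Lnorm_Z l : ('N[P]_p%:E[EFin \o Z l] <=
  (n%:R `^ (1 / p) * 2 `^ (- (l%:R / p)))%:E * 'N[P]_p%:E[EFin \o Y (2 ^ l)])%E.
Proof.
rewrite Lnorm_lp_sum//.
under eq_bigr do rewrite Lnorm_iter//.
set N := 'N[P]_p%:E[_]%E.
have N0 : (0 <= N)%E by exact: Lnorm_ge0.
have -> : (\sum_(1 <= k < (n %/ 2 ^ l).+1) N `^ p = (n %/ 2 ^ l)%:R%:E * N `^ p)%E.
  by rewrite sumr_const_nat subSS subn0 mule_natl.
rewrite poweRM ?poweR_ge0 ?lee_fin ?ler0n// -poweRrM mulfV ?gt_eqF// poweRe1//.
apply: lee_wpmul2r => //; rewrite poweR_EFin lee_fin.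
have -> : n%:R `^ (1 / p) * 2 `^ (- (l%:R / p)) = (n%:R / 2 ^+ l) `^ p^-1 :> R.
  rewrite powRM ?invr_ge0 ?exprn_ge0// div1r; congr (_ * _).
  by rewrite -mulNr powRrM -powR_mulrn// -powRN.
apply: ge0_ler_powR; rewrite ?nnegrE ?invr_ge0 ?(ltW p0) ?ler0n//.
by rewrite ler_pdivlMr ?exprn_gt0// -natrX -natrM ler_nat leq_divM.
Qed.

Let measurable_maxf (f : nat -> Omega -> R) :
  (forall j, measurable_fun setT (f j)) -> measurable_fun setT (maxf f).
Proof.
move=> mf; rewrite /maxf; elim: (n) => [|m IH].
  by rewrite (_ : (fun w => _) = cst 0)//; apply/funext => w; rewrite big_geq.
rewrite (_ : (fun w => _) = (fun w => \big[Num.max/0%R]_(1 <= i < m.+1) `|f i w|%R)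
    \max (fun w => `|f m.+1 w|)); last first.
  by apply/funext => w; rewrite bigmaxr_nat_recr.
by apply: measurable_maxr => //; exact: measurableT_comp.
Qed.

Let maxf_ge0 f w : 0 <= maxf f w.
Proof.
rewrite /maxf; elim: (n) => [|m IH]; first by rewrite big_geq.
by rewrite bigmaxr_nat_recr// le_max IH.
Qed.

Let le_maxf f w i : (1 <= i < n.+1)%N -> `|f i w| <= maxf f w.
Proof.
move=> i1n; apply: (le_bigmax_seq 0 i xpredT (fun i => `|f i w|)) => //.
by rewrite mem_index_iota.
Qed.

Let maxf_le f w (c : R) : 0 <= c ->
  (forall i, (1 <= i < n.+1)%N -> `|f i w| <= c) -> maxf f w <= c.
Proof.
rewrite /maxf => c0; elim: (n) => [_|m IH fc]; first by rewrite big_geq.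
rewrite bigmaxr_nat_recr// ge_max fc ?ltnSn// andbT.
by apply: IH => i /andP[i1 im]; apply: fc; rewrite i1/= ltnW.
Qed.

Theorem maximal_inequality_dyadic :
  ('N[P]_p%:E[EFin \o (fun w => \big[Num.max/0%R]_(1 <= i < n.+1) `|S i w|%R)] <=
   q%:E * 'N[P]_p%:E[EFin \o S n] + (q * n%:R `^ (1 / p))%:E *
     \sum_(l < r) (2 `^ (- (l%:R / p)))%:E * 'N[P]_p%:E[EFin \o Y (2 ^ l)])%E.
Proof.
have mMO l j : measurable_fun setT (M l j).
  have [MF _ _] := MP l j.
  exact: (sub_measurable_fun (sigma_algebra_shifted j) (@shifted_measurable j) MF).
have mM0 j : measurable_fun setT (M0 j).
  by apply/measurable_EFinP; exact: measurable_int (iM0 j).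
have mS := birkhoff_sum_measurable.
pose bound w := maxf M0 w + \sum_(l < r) maxf (M l) w.
have bound0 w : 0 <= bound w by rewrite addr_ge0// sumr_ge0.
have msum : measurable_fun setT (fun w => \sum_(l < r) maxf (M l) w).
  by apply: measurable_sum => l; exact: measurable_maxf.
apply: (@le_trans _ _ ('N[P]_p%:E[EFin \o bound])%E).
  apply: le_Lnorm => //.
  - exact: measurable_maxf.
  - by apply: measurable_funD => //; exact: measurable_maxf.
  - move=> w; rewrite ger0_norm; last exact: (maxf_ge0 S).
    rewrite ger0_norm//; apply: (maxf_le (f := S)) => // i i1n.
    rewrite (_ : S i w = M0 i w - \sum_(l < r) M l i w); last by rewrite /M0 addrK.
    apply: (le_trans (ler_normB _ _)); apply: lerD; first exact: le_maxf.
    apply: (le_trans (ler_norm_sum _ _ _)); apply: ler_sum => l _.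
    exact: (le_maxf (M l)).
apply: (@le_trans _ _ ('N[P]_p%:E[EFin \o maxf M0] +
    'N[P]_p%:E[EFin \o (fun w => \sum_(l < r) maxf (M l) w)%R])%E).
  apply: minkowski_EFin => //; last exact: ltW.
  exact: measurable_maxf.
apply: leeD.
  (* The martingale term is dominated by [|S n|], the block terms below by [Z l]. *)
  rewrite -(Lnorm_norm P (S n)); apply: doobM => //.
  - exact: measurableT_comp.
  - move=> j A jn FA.
    apply: (le_integral_norm (sigma_algebra_shifted j) (@shifted_measurable j)) => //.
    + exact: integrable_birkhoff_sum.
    + by move=> B FB; exact: M0_int.
apply: (le_trans (Lnorm_sum_le P p1 _ _)); first by move=> l; exact: measurable_maxf.
rewrite ge0_sume_distrr; last first.
  by move=> l _; rewrite mule_ge0 ?Lnorm_ge0// lee_fin powR_ge0.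
apply: lee_sum => l _.
apply: (@le_trans _ _ (q%:E * 'N[P]_p%:E[EFin \o Z l])%E).
  by apply: doobM => // j; [have [] := MP l j|exact: M_le_Z].
rewrite muleA -EFinM -mulrA EFinM -muleA.
by apply: lee_wpmul2l; [rewrite lee_fin ltW|exact: Lnorm_Z].
Qed.

End stationary.

(** * Dyadic sums of subadditive sequences *)

(** Pair [j] with [N - j] in [a N <= a j + a (N - j)] and sum over [0 < j < N]; the missing copy of
    [a N] comes from the last term of the sum. *)
Lemma subadditive_le_sum (R : realFieldType) (a : nat -> R) (N : nat) :
  (forall k, 0 <= a k) -> (forall m k, a (m + k)%N <= a m + a k) -> (0 < N)%N ->
  N%:R * a N <= 2 * \sum_(1 <= j < N.+1) a j.
Proof.
move=> a0 aD; case: N => // N _.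
have : \sum_(1 <= j < N.+1) a N.+1 <= \sum_(1 <= j < N.+1) (a j + a (N.+1 - j)%N).
  by rewrite !big_nat; apply: ler_sum => j /andP[_ jN]; rewrite -{1}(subnKC (ltnW jN)).
rewrite sumr_const_nat subSS subn0 big_split/= -mulr_natl.
rewrite [X in _ + X]big_nat_rev/=.
have -> : \sum_(1 <= j < N.+1) a (N.+1 - (1 + N.+1 - j.+1))%N = \sum_(1 <= j < N.+1) a j.
  rewrite !big_nat; apply: eq_bigr => j /andP[_ jN].
  by congr a; lia.
rewrite [in X in _ -> X]big_nat_recr//= -(natr1 N).
have := a0 N.+1; lra.
Qed.

(* Summation by parts over dyadic blocks: [(1 - x) * \sum_l x^l A(2^l)]
   telescopes, and [x^l = (2^l)^(-alpha) <= j^(-alpha)] for [j <= 2^l]. *)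
Lemma sum_dyadic_partial_sums (R : realType) (a : nat -> R) (alpha x : R) (r : nat) :
  (forall k, 0 <= a k) -> 0 < alpha -> x = 2 `^ (- alpha) ->
  (1 - x) * \sum_(l < r.+1) x ^+ l * \sum_(1 <= j < (2 ^ l).+1) a j
    + x ^+ r.+1 * \sum_(1 <= j < (2 ^ r).+1) a j
  <= \sum_(1 <= j < (2 ^ r).+1) j%:R `^ (- alpha) * a j.
Proof.
move=> a0 alpha0 xE; elim: r => [|r IH].
  by rewrite big_ord1 expn0 !big_nat1 expr0 powR1 mulrC; lra.
have r2 : (2 ^ r <= 2 ^ r.+1)%N by rewrite leq_exp2l.
have split f : \sum_(1 <= j < (2 ^ r.+1).+1) f j = \sum_(1 <= j < (2 ^ r).+1) f j
    + \sum_((2 ^ r).+1 <= j < (2 ^ r.+1).+1) f j :> R by rewrite -big_cat_nat.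
rewrite big_ord_recr/= !split.
set A := \sum_(1 <= j < (2 ^ r).+1) a j in IH *.
set A' := \sum_((2 ^ r).+1 <= j < (2 ^ r.+1).+1) a j.
set U := \sum_(l < r.+1) _ in IH *.
set B := \sum_(1 <= j < (2 ^ r).+1) _ in IH *.
have : x ^+ r.+1 * A' <=
    \sum_((2 ^ r).+1 <= j < (2 ^ r.+1).+1) j%:R `^ (- alpha) * a j.
  rewrite mulr_sumr !big_nat; apply: ler_sum => j /andP[jr rj].
  apply: ler_wpM2r => //.
  have -> : x ^+ r.+1 = (2 ^ r.+1)%:R `^ (- alpha).
    by rewrite xE -powR_mulrn ?powR_ge0// -powRrM mulrC powRrM powR_mulrn// natrX.
  rewrite !powRN lef_pV2 ?posrE ?powR_gt0 ?ltr0n ?expn_gt0//; last exact: leq_trans jr.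
  by apply: ge0_ler_powR; rewrite ?nnegrE ?ler0n ?ler_nat// ltW.
(* The two new terms have coefficients [(1 - x) * y] and [x * y], which add up to [y]. *)
move: IH; rewrite (exprS x r.+1); set y := x ^+ r.+1; nra.
Qed.

(** With [x = 2^(-1-1/p)] one has [2^(-l/p) = x^l 2^l], so subadditivity bounds each term by [2 x^l]
    times a partial sum of [a]; summation by parts then gives the constant [2 / (1 - x)]. *)
Lemma sum_dyadic_subadditive (R : realType) (a : nat -> R) (p : R) (r : nat) :
  0 < p -> (forall k, 0 <= a k) -> (forall m k, a (m + k)%N <= a m + a k) ->
  \sum_(l < r.+1) 2 `^ (- (l%:R / p)) * a (2 ^ l)%N <=
  2 `^ (2 + 1 / p) / (2 `^ (1 + 1 / p) - 1) *
    \sum_(1 <= j < (2 ^ r).+1) j%:R `^ (- 1 - 1 / p) * a j.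
Proof.
move=> p0 a0 aD; pose alpha := 1 + 1 / p.
have alpha0 : 0 < alpha by rewrite addr_gt0// divr_gt0.
pose x : R := 2 `^ (- alpha).
have t1 : 1 < 2 `^ alpha.
  have : 1 `^ alpha < 2 `^ alpha by apply: gt0_ltr_powR; rewrite ?nnegrE// ltr1n.
  by rewrite powR1.
have x0 : 0 < x by rewrite powR_gt0.
have xE : x = (2 `^ alpha)^-1 by rewrite /x powRN.
have x1 : x < 1 by rewrite xE invf_lt1// (lt_trans ltr01).
pose U := \sum_(l < r.+1) x ^+ l * \sum_(1 <= j < (2 ^ l).+1) a j.
have lU : \sum_(l < r.+1) 2 `^ (- (l%:R / p)) * a (2 ^ l)%N <= 2 * U.
  rewrite mulr_sumr; apply: ler_sum => l _; rewrite mulrCA.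
  have -> : 2 `^ (- (l%:R / p)) = x ^+ l * (2 ^ l)%:R :> R.
    rewrite /x -powR_mulrn ?powR_ge0// -powRrM natrX -powR_mulrn// -powRD.
      by congr (_ `^ _); rewrite /alpha; field; rewrite gt_eqF.
    by rewrite pnatr_eq0 implybT.
  rewrite -mulrA ler_wpM2l ?exprn_ge0 ?(ltW x0)//.
  by apply: subadditive_le_sum => //; rewrite expn_gt0.
apply: (le_trans lU).
have := sum_dyadic_partial_sums r a0 alpha0 erefl; rewrite -/x -/U.
have -> : - alpha = - 1 - 1 / p by rewrite /alpha opprD.
set B := \sum_(1 <= j < _) j%:R `^ _ * _; set A := \sum_(1 <= j < _) a j => UB.
have A0 : 0 <= x ^+ r.+1 * A.
  by rewrite mulr_ge0 ?exprn_ge0 ?(ltW x0)// sumr_ge0.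
have -> : 2 `^ (2 + 1 / p) / (2 `^ (1 + 1 / p) - 1) = 2 / (1 - x) :> R.
  have -> : 2 + 1 / p = 1 + alpha by rewrite /alpha addrA.
  rewrite powRD ?pnatr_eq0 ?implybT// powRr1// -/alpha xE; field.
  by rewrite !gt_eqF ?subr_gt0// (lt_trans ltr01).
rewrite -mulrA ler_pM2l// mulrC ler_pdivlMr ?subr_gt0// mulrC.
by apply: le_trans UB; rewrite lerDl.
Qed.

(** * Deduction of both inequalities from the dyadic bound *)

Theorem mainTheorem3 (R : realType) (d : measure_display)
  (Omega : measurableType d) (P : probability Omega R)
  (T Tinv : Omega -> Omega)
  (TK : cancel T Tinv) (TinvK : cancel Tinv T)
  (mT : measurable_fun [set: Omega] T)
  (mTinv : measurable_fun [set: Omega] Tinv)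
  (PT : forall A : set Omega, measurable A -> P (T @^-1` A) = P A)
  (F0 : set_system Omega)
  (sF0 : sigma_algebra [set: Omega] F0)
  (F0m : F0 `<=` measurable)
  (F0T : F0 `<=` preimage_set_system [set: Omega] T F0)
  (p q : R) (p1 : 1 < p) (qE : q = p / (p - 1))
  (X : int -> Omega -> R)
  (X0Lp : X 0 \in Lfun P p%:E)
  (XE : forall i : int, X i = X 0 \o iterz T Tinv i)
  (X0F0 : measurable_fun [set: g_sigma_algebraType F0]
            (X 0 : g_sigma_algebraType F0 -> R))
  (S : nat -> Omega -> R)
  (SE : forall n w, S n w = \sum_(1 <= j < n.+1) X j%:Z w) :
  (forall r n : nat, (0 < r)%N -> (2 ^ r.-1 <= n < 2 ^ r)%N ->
    ('N[P]_p%:E [(fun w => (\big[Num.max/0%R]_(1 <= i < n.+1) `|S i w|%R)%:E)]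
     <= (2 * q)%:E *
          \big[Order.max/0]_(1 <= m < n.+1) 'N[P]_p%:E [EFin \o S m]
        + (2 `^ (1 / p) * q * n%:R `^ (1 / p))%:E *
          \sum_(0 <= l < r)
            (2 `^ (- (l%:R / p)))%:E *
            'N[P]_p%:E [EFin \o cond_exp P F0 (S (2 ^ l)%N)])%E)
  /\
  (forall n : nat, (0 < n)%N ->
    ('N[P]_p%:E [(fun w => (\big[Num.max/0%R]_(1 <= i < n.+1) `|S i w|%R)%:E)]
     <= (2 * q)%:E *
          \big[Order.max/0]_(1 <= m < n.+1) 'N[P]_p%:E [EFin \o S m]
        + (q * (2 `^ (2 + 2 / p) / (2 `^ (1 + 1 / p) - 1)) *
            n%:R `^ (1 / p))%:E *
          \sum_(1 <= j < n.+1)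
            (j%:R `^ (- 1 - 1 / p))%:E *
            'N[P]_p%:E [EFin \o cond_exp P F0 (S j)])%E).
Proof.
have p0 : 0 < p by rewrite (lt_trans ltr01).
have q0 : 0 < q by rewrite qE divr_gt0// subr_gt0.
have SB : S = birkhoff_sum T (X 0).
  by apply/funext => m; apply/funext => w; rewrite SE; apply: eq_bigr => j _; rewrite XE.
(* The norms are finite, so the dyadic sums can be handled as sums of reals. *)
pose a k := fine 'N[P]_p%:E[EFin \o cond_exp P F0 (S k)]%E.
have aE k : ((a k)%:E = 'N[P]_p%:E[EFin \o cond_exp P F0 (S k)])%E.
  rewrite fineK// ge0_fin_numE ?Lnorm_ge0// SB.
  exact: (Lnorm_cond_exp_lty mT PT sF0 F0m p1 X0Lp).
have a0 k : 0 <= a k by rewrite -lee_fin aE Lnorm_ge0.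
have aD m k : a (m + k)%N <= a m + a k.
  rewrite -lee_fin EFinD !aE SB.
  exact: (Lnorm_cond_exp_subadditive mT PT sF0 F0m F0T p1 X0Lp).
pose maxS n := 'N[P]_p%:E[(fun w => (\big[Num.max/0%R]_(1 <= i < n.+1) `|S i w|%R)%:E)]%E.
pose supS n := (\big[Order.max/0]_(1 <= m < n.+1) 'N[P]_p%:E [EFin \o S m])%E.
(* A common bound for both parts, with the second constant still [q]. *)
have main r n : (0 < n)%N -> (n < 2 ^ r)%N ->
    (maxS n <= (2 * q)%:E * supS n +
      (q * n%:R `^ (1 / p) * \sum_(l < r) 2 `^ (- (l%:R / p)) * a (2 ^ l)%N)%:E)%E.
  move=> n0 nr; rewrite /maxS [in leLHS]SB.
  apply: (le_trans (maximal_inequality_dyadic mT PT sF0 F0m F0T p1 qE X0Lp X0F0 nr)).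
  rewrite -SB; apply: leeD.
    have supS0 : ('N[P]_p%:E[EFin \o S n] <= supS n)%E.
      apply: (le_bigmax_seq 0%E n xpredT (fun m => 'N[P]_p%:E [EFin \o S m]%E)) => //.
      by rewrite mem_index_iota n0 ltnSn.
    apply: lee_pmul => //; rewrite ?lee_fin ?Lnorm_ge0 ?(ltW q0)//.
    by rewrite ler_peMl ?(ltW q0)// ler1n.
  rewrite [leRHS]EFinM -sumEFin; under [in leRHS]eq_bigr do rewrite EFinM aE.
  exact: lexx.
split=> [r n r0 /andP[rn nr]|n n0].
  have n0 : (0 < n)%N by apply: leq_trans rn; rewrite expn_gt0.
  apply: (le_trans (main r n n0 nr)); apply: leeD; first exact: lexx.
  rewrite big_mkord; under [in leRHS]eq_bigr do rewrite -aE -EFinM.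
  rewrite sumEFin -EFinM lee_fin; apply: ler_wpM2r.
    by apply: sumr_ge0 => l _; rewrite mulr_ge0 ?powR_ge0.
  rewrite ler_wpM2r ?powR_ge0// ler_peMl ?(ltW q0)//.
  (* The factor [2^(1/p)] of (i) is at least [2^0 = 1]. *)
  rewrite -[leLHS](powRr0 2); apply: ler_powR; first by rewrite ler1n.
  by rewrite divr_ge0 ?ltW.
(* With [2 ^ r <= n < 2 ^ r.+1], the dyadic bound is used at [r.+1]; its levels stop at [r], so only
   indices [j <= 2 ^ r <= n] occur. *)
have /andP[rn nr] := trunc_log_bounds (isT : (1 < 2)%N) n0.
set r := trunc_log 2 n in rn nr.
apply: (le_trans (main r.+1 n n0 nr)); apply: leeD; first exact: lexx.
under [in leRHS]eq_bigr do rewrite -aE -EFinM.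
rewrite sumEFin -EFinM lee_fin.
rewrite [in leRHS](mulrAC q) -[leRHS]mulrA.
apply: ler_wpM2l; first by rewrite mulr_ge0 ?powR_ge0 ?(ltW q0).
apply: (le_trans (sum_dyadic_subadditive r p0 a0 aD)).
have t1 : 1 < 2 `^ (1 + 1 / p) :> R.
  have : 1 `^ (1 + 1 / p) < 2 `^ (1 + 1 / p) :> R.
    by apply: gt0_ltr_powR; rewrite ?nnegrE ?ltr1n// addr_gt0// divr_gt0.
  by rewrite powR1.
apply: ler_pM.
- by rewrite divr_ge0 ?powR_ge0 ?subr_ge0 ?ltW.
- by apply: sumr_ge0 => j _; rewrite mulr_ge0 ?powR_ge0.
- rewrite ler_wpM2r ?invr_ge0 ?subr_ge0 ?(ltW t1)//.
  (* Here [2 + 1/p] is relaxed to the exponent [2 + 2/p] of (ii). *)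
  apply: ler_powR; first by rewrite ler1n.
  by rewrite lerD2l ler_wpM2r ?invr_ge0 ?(ltW p0)// ler1n.
- rewrite [leRHS](big_cat_nat (n := (2 ^ r).+1))//= lerDl.
  by apply: sumr_ge0 => j _; rewrite mulr_ge0 ?powR_ge0.
Qed.
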